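(* Let $d\ge 0$ be an integer and, for $z\in\mathbf{C}$, set $r(z,\overline z)=(1+|z|^2)^d$. Let $p=(p_1,\dots,p_k)$ be a finite tuple of polynomials in the one variable $z$ with complex coefficients, not all identically $0$, and let $\|p(z)\|^2=\sum_{j=1}^k|p_j(z)|^2$. Assume that $\|p\|^2$ is a multiple of $r$, i.e. $\|p(z)\|^2=r(z,\overline z)\,s(z,\overline z)$ for some polynomial $s$ in $(z,\overline z)$ with complex coefficients. Then $\mathbf{r}(\|p\|^2)\ge d+1$. Moreover, equality is possible: for every $d$ there is such a $p$ with $\mathbf{r}(\|p\|^2)=d+1$.
   Context: A polynomial in $(z,\overline z)$, $z\in\mathbf{C}$, is written as $g(z,\overline z)=\sum_{a,b}c_{a,b}z^a\overline z^b$ (a finite sum with $c_{a,b}\in\mathbf{C}$ and $a,b$ nonnegative integers). The rank $\mathbf{r}(g)$ is the rank of the matrix $(c_{a,b})$. *)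

(* Defs.v *)
From mathcomp Require Export all_boot all_order all_algebra.
From mathcomp Require Export polyXY.
From mathcomp Require Import ring.
From mathcomp Require Export complex.
From mathcomp Require Export reals.

Set Implicit Arguments.
Unset Strict Implicit.
Unset Printing Implicit Defensive.

Import Order.TTheory GRing.Theory Num.Theory.
Local Open Scope ring_scope.

(* g = \sum_(a, b) c_(a,b) z^a zbar^b is encoded as g : {poly {poly R[i]}} with
   g`_a`_b = c_(a,b): the outer indeterminate is z and the inner one is zbar.
   So, in the notation of polyXY, its value at the point z is g.[z, z^*].
   Distinct g take distinct values somewhere (polyzz_inj below), hence the
   coefficients are determined by the function z |-> g.[z, z^*]. *)
Notation polyzz R := {poly {poly R[i]}}.

(* All the coefficients outside the first size g rows and sizeY g columns of
   the infinite matrix (c_(a,b)) are zero. *)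
Definition rankzz (R : realType) (g : polyzz R) : nat :=
  \rank (\matrix_(a < size g, b < sizeY g) g`_a`_b).

Definition normsq (R : realType) (k : nat) (p : 'I_k -> {poly R[i]}) :
    polyzz R :=
  \sum_(j < k) (p j)^:P * (map_poly Num.conj (p j))%:P.

Lemma normsqE (R : realType) (k : nat) (p : 'I_k -> {poly R[i]}) (z : R[i]) :
  (normsq p).[z, z^*] = \sum_(j < k) `|(p j).[z]| ^+ 2.
Proof.
rewrite /normsq !horner_sum; apply: eq_bigr => j _.
by rewrite !hornerM hornerC horner_map /= hornerC horner_map /= normCK.
Qed.

Lemma poly_nat0 (D : idomainType) (q : {poly D}) :
  injective (fun n : nat => n%:R : D) -> (forall n : nat, q.[n%:R] = 0) ->
  q = 0.
Proof.
move=> injn q0; apply/eqP/negPn/negP => qn0.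
have : (size [seq (n%:R : D) | n <- iota 0 (size q)] < size q)%N.
  apply: max_poly_roots => //; last by rewrite map_inj_uniq ?iota_uniq.
  by apply/allP => _ /mapP [n _ ->]; apply/rootP.
by rewrite size_map size_iota ltnn.
Qed.

Lemma horner_comp2 (R : comNzRingType) (u : {poly {poly R}}) (a b : {poly R})
    (x : R) :
  (map_poly (comp_poly b) u).[a].[x] = u.[a.[x], b.[x]].
Proof.
elim/poly_ind: u => [|u c IHu]; first by rewrite rmorph0 !horner0.
by rewrite rmorphD rmorphM /= map_polyX map_polyC /= !hornerE horner_comp IHu.
Qed.

Lemma polyzz_inj (R : realType) (g h : polyzz R) :
  (forall z : R[i], g.[z, z^*] = h.[z, z^*]) -> g = h.
Proof.
suff H (u : polyzz R) : (forall z : R[i], u.[z, z^*] = 0) -> u = 0.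
  move=> gh; apply/eqP; rewrite -subr_eq0; apply/eqP/H => z.
  by rewrite !hornerE gh subrr.
move=> u0.
have injC : injective (fun n : nat => n%:R : R[i]).
  by move=> m n /eqP; rewrite eqr_nat => /eqP.
have injP : injective (fun n : nat => n%:R : {poly R[i]}).
  by move=> m n; rewrite /= -!polyC_natr => /polyC_inj /injC.
(* z and zbar are replaced by x + i y and x - i y; first y is a natural number
   and x is freed, then y is. *)
have u1 (x : R[i]) (n : nat) : u.[x + 'i * n%:R, x - 'i * n%:R] = 0.
  pose a : {poly R[i]} := 'X + ('i * n%:R)%:P.
  pose b : {poly R[i]} := 'X - ('i * n%:R)%:P.
  have <- : (map_poly (comp_poly b) u).[a].[x] = u.[x + 'i * n%:R, x - 'i * n%:R].
    by rewrite horner_comp2 /a /b !hornerE.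
  rewrite (poly_nat0 (q := (map_poly (comp_poly b) u).[a]) injC) ?horner0 //.
  move=> m; rewrite horner_comp2 /a /b !hornerE -[RHS](u0 (m%:R + 'i * n%:R)).
  have -> : (m%:R + 'i * n%:R)^* = m%:R - 'i * n%:R :> R[i].
    by rewrite rmorphD rmorphM !rmorph_nat /= conjCi mulNr.
  by [].
have u2 (x y : R[i]) : u.[x + 'i * y, x - 'i * y] = 0.
  pose a : {poly R[i]} := x%:P + 'i%:P * 'X.
  pose b : {poly R[i]} := x%:P - 'i%:P * 'X.
  have <- : (map_poly (comp_poly b) u).[a].[y] = u.[x + 'i * y, x - 'i * y].
    by rewrite horner_comp2 /a /b !hornerE.
  rewrite (poly_nat0 (q := (map_poly (comp_poly b) u).[a]) injC) ?horner0 //.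
  by move=> m; rewrite horner_comp2 /a /b !hornerE.
apply: (poly_nat0 injP) => m; apply: (poly_nat0 injC) => n.
rewrite -polyC_natr -[RHS](u2 ((m%:R + n%:R) / 2) ((m%:R - n%:R) / (2 * 'i))).
have i0 : 'i != 0 :> R[i] by rewrite neq0Ci.
have n2 : 2 != 0 :> R[i] by rewrite pnatr_eq0.
by congr (_.[_, _]); field; rewrite ?i0 ?n2.
Qed.

(* Main.v *)
Require Import Defs.
From mathcomp Require Import zify.

Set Implicit Arguments.
Unset Strict Implicit.
Unset Printing Implicit Defensive.

Import Order.TTheory GRing.Theory Num.Theory.
Local Open Scope ring_scope.

(** On each diagonal a - b = m, the coefficients of a multiple of (1 + z zbar)^d
    are those of a univariate multiple of (1 + t)^d, which, if nonzero, has at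
    least d + 1 nonzero coefficients. For the largest m whose diagonal is
    nonzero, the rows and columns of d + 1 such entries cut out a triangular
    submatrix with a nonzero diagonal. The bound d + 1 is attained by the
    binomial expansion of (1 + |z|^2)^d. *)

Lemma dvdp_exp_deriv (F : fieldType) (u q : {poly F}) (d : nat) :
  u ^+ d.+1 %| q -> u ^+ d %| q^`().
Proof.
case/dvdpP => h ->; rewrite derivM deriv_exp /=.
apply: dvdp_add; first by rewrite exprS mulrA; apply: dvdp_mulIr.
by rewrite -[_ *+ _]mulr_natl !dvdp_mull.
Qed.

(** Induction on d: a first-order operator costs one factor 1 + t and removes only the leading
    monomial, the other nonzero coefficients staying nonzero in characteristic zero. *)
Lemma dvdp_exp_card_coef (F : numFieldType) (d n : nat) (q : {poly F}) :
  q != 0 -> (size q <= n)%N -> (1 + 'X) ^+ d %| q ->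
  (d < #|[set i : 'I_n | (q`_i != 0)%R]|)%N.
Proof.
elim: d q => [|d IHd] q q0 qn dvq.
  have lt_n : ((size q).-1 < n)%N by rewrite prednK // size_poly_gt0.
  by apply/card_gt0P; exists (Ordinal lt_n); rewrite inE -lead_coefE lead_coef_eq0.
have lt_n : ((size q).-1 < n)%N by rewrite prednK // size_poly_gt0.
pose k := Ordinal lt_n.
have qk : q`_k != 0 by rewrite -lead_coefE lead_coef_eq0.
(* The operator t d/dt - k removes exactly the k-th monomial from the support. *)
pose v := 'X * q^`() - k%:R *: q.
have vE i : v`_i = (i%:R - k%:R) * q`_i.
  rewrite coefB coefXM coefZ coef_deriv mulrBl; congr (_ - _).
  by case: i => [|i] /=; rewrite ?mul0r // mulr_natl.
have v_supp : [set i : 'I_n | v`_i != 0] = [set i : 'I_n | q`_i != 0] :\ k.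
  apply/setP => i; rewrite !inE vE mulf_eq0 negb_or subr_eq0 eqr_nat.
  by rewrite -val_eqE.
have v_dvd : (1 + 'X) ^+ d %| v.
  apply: dvdp_sub; first by rewrite dvdp_mull ?dvdp_exp_deriv.
  rewrite -mul_polyC dvdp_mull // (dvdp_trans _ dvq) //.
  by rewrite exprS dvdp_mulIr.
(* If v were 0, q would be a nonzero multiple of X^k, which does not vanish at -1, although 1 + X
   divides q. *)
have v0 : v != 0.
  apply/negP => /eqP v0.
  have qE : q = q`_k *: 'X^k.
    apply/polyP => i; rewrite coefZ coefXn.
    have := vE i; rewrite v0 coef0 => /esym/eqP.
    rewrite mulf_eq0 subr_eq0 eqr_nat.
    by case: eqP => [-> _|_ /= /eqP ->]; rewrite ?mulr1 ?mulr0.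
  have : root q (-1).
    by case/dvdpP: dvq => h ->; rewrite rootE exprS !hornerE subrr /= mulr0 mul0r.
  rewrite qE rootE !hornerE mulf_eq0 (negbTE qk) /=.
  by rewrite expf_eq0 oppr_eq0 oner_eq0 andbF.
have vn : (size v <= n)%N.
  apply/leq_sizeP => i ni; rewrite vE (_ : q`_i = 0) ?mulr0 //.
  by apply/nth_default/(leq_trans qn).
have := IHd v v0 vn v_dvd; rewrite v_supp.
by rewrite [X in _ -> (_ < X)%N](cardsD1 k) inE qk.
Qed.

Definition diag_poly (A : nzRingType) (a b : nat) (u : {poly {poly A}}) : {poly A} :=
  \poly_(k < size u) u`_(a + k)`_(b + k).

Lemma coef_diag_poly (A : nzRingType) (a b : nat) (u : {poly {poly A}}) (k : nat) :
  (diag_poly a b u)`_k = u`_(a + k)`_(b + k).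
Proof.
rewrite coef_poly; case: ltnP => // uk.
by rewrite [u`__]nth_default ?coef0 // (leq_trans uk) // leq_addl.
Qed.

(** Multiplication by ['X * 'Y] moves each diagonal one step along itself. As a or b is 0, (a, b) is
    the first position of its diagonal, so nothing enters from before it. *)
Lemma diag_polyM (A : comNzRingType) (a b d : nat) (s : {poly {poly A}}) :
  (a == 0)%N || (b == 0)%N ->
  diag_poly a b ((1 + 'X * 'Y) ^+ d * s) = (1 + 'X) ^+ d * diag_poly a b s.
Proof.
move=> ab0; elim: d => [|d IHd]; first by rewrite !expr0 !mul1r.
rewrite !exprS -!mulrA -IHd; move: (_ * s) => u.
apply/polyP => k; rewrite !mulrDl !mul1r coefD coefXM !coef_diag_poly coefD.
rewrite coefD -mulrA coefXM coefCM; congr (_ + _).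
case: k => [|k]; last by rewrite !addnS /= coefXM /=.
rewrite !addn0; case/orP: ab0 => /eqP -> /=; first by rewrite coef0.
by case: eqP; rewrite ?coef0 // coefXM.
Qed.

Lemma mxrank_mxsub (F : fieldType) (m n m' n' : nat) (f : 'I_m' -> 'I_m)
    (h : 'I_n' -> 'I_n) (A : 'M[F]_(m, n)) :
  (\rank (mxsub f h A) <= \rank A)%N.
Proof.
rewrite mxsubcr -mxrank_tr trmx_mxsub.
apply: leq_trans (mxrankS (rowsub_sub _ _)) _.
by rewrite mxrank_tr mxrankS ?rowsub_sub.
Qed.

Lemma mxrank_multiple (F : numFieldType) (d : nat) (g s : {poly {poly F}}) :
  g != 0 -> g = (1 + 'X * 'Y) ^+ d * s ->
  (d < \rank (\matrix_(a < size g, b < sizeY g) g`_a`_b)%R)%N.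
Proof.
move=> g0 gE.
have bnd i j : g`_i`_j != 0 -> (i < size g)%N && (j < sizeY g)%N.
  move=> gij; apply/andP; split.
    rewrite ltnNge; apply: contra gij => /leq_sizeP/(_ _ (leqnn _)) ->.
    by rewrite coef0.
  apply: leq_trans (max_size_coefXY _ i); rewrite ltnNge.
  by apply: contra gij => /leq_sizeP/(_ _ (leqnn _)) ->.
have [i0 gi0] : exists x : 'I_(size g) * 'I_(sizeY g), g`_x.1`_x.2 != 0.
  have : g`_(size g).-1`_(size g`_(size g).-1).-1 != 0.
    by rewrite -!lead_coefE !lead_coef_eq0.
  move=> gn; have /andP [ha hb] := bnd _ _ gn.
  by exists (Ordinal ha, Ordinal hb).
(* This is the diagonal index raised by [sizeY g] to stay in [nat]; column indices are below
   [sizeY g], so the subtraction is exact. *)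
pose wt (x : 'I_(size g) * 'I_(sizeY g)) := (x.1 + (sizeY g - x.2))%N.
case: (@arg_maxnP _ i0 (fun x => g`_x.1`_x.2 != 0) wt gi0) => -[[a ha] [b hb]] /= gab max_ab {i0 gi0}.
have zero_above i j : (a + j < i + b)%N -> g`_i`_j = 0.
  move=> ab_ij; apply/eqP/negPn/negP => gij.
  have /andP [hi hj] := bnd _ _ gij.
  have := max_ab (Ordinal hi, Ordinal hj) gij; rewrite /wt /=; lia.
(* With truncated subtraction, (a - b, b - a) is the first position of the
   diagonal through (a, b). *)
pose q := diag_poly (a - b) (b - a) g.
have qE k : q`_k = g`_(a - b + k)`_(b - a + k) by rewrite coef_diag_poly.
have q0 : q != 0.
  (* The nonzero entry (a, b) sits at step [minn a b] of its diagonal. *)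
  apply/eqP => q0; case/negP: gab; have := qE (minn a b).
  rewrite q0 coef0 (_ : a - b + minn a b = a)%N; last by lia.
  by rewrite (_ : b - a + minn a b = b)%N; [move/esym/eqP | lia].
have q_dvd : (1 + 'X) ^+ d %| q.
  by rewrite /q gE diag_polyM ?dvdp_mulIl //; lia.
have := dvdp_exp_card_coef q0 (leqnn _) q_dvd.
set K := [set i | _] => dK; apply: (leq_trans dK) => {dK}.
have Kq (i : 'I_#|K|) : q`_(Order.enum_val i : 'I__) != 0.
  by have := Order.enum_valP i; rewrite inE.
have Kr (i : 'I_#|K|) : (a - b + (Order.enum_val i : 'I__) < size g)%N.
  by have := Kq i; rewrite qE => /bnd /andP [].
have Kc (i : 'I_#|K|) : (b - a + (Order.enum_val i : 'I__) < sizeY g)%N.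
  by have := Kq i; rewrite qE => /bnd /andP [].
set A := \matrix_(_, _) _.
pose T := mxsub (fun i => Ordinal (Kr i)) (fun j => Ordinal (Kc j)) A.
apply: leq_trans (mxrank_mxsub (fun i => Ordinal (Kr i)) (fun j => Ordinal (Kc j)) A).
suff T_unit : T \in unitmx by rewrite -/T mxrank_unit.
(* [Order.enum_val] lists [K] increasingly, so an entry of [T] below the main diagonal comes from a
   diagonal of g beyond the maximal one and vanishes; those on the main diagonal are nonzero
   coefficients of q. *)
rewrite unitmxE -det_tr det_trig.
  rewrite unitfE; apply/prodf_neq0 => i _.
  by rewrite !mxE /= -qE.
apply/is_trig_mxP => i j ij; rewrite !mxE /=; apply: zero_above.
have : ((Order.enum_val i : 'I__) < (Order.enum_val j : 'I__))%O.
  by rewrite (leW_mono (@Order.le_enum_val _ _ (@le_total _ _) (mem K))).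
rewrite ltEord /=.
by move: (nat_of_ord (Order.enum_val i)) (nat_of_ord (Order.enum_val j)); lia.
Qed.

(** A vanishing sum of squared moduli forces each p_j to vanish at every natural number, hence
    identically. *)
Lemma normsq_neq0 (R : realType) (k : nat) (p : 'I_k -> {poly R[i]}) :
  (exists j, p j != 0) -> normsq p != 0.
Proof.
case=> j pj; apply: contra pj => /eqP p0; apply/eqP/poly_nat0 => [m n /eqP|n].
  by rewrite eqr_nat => /eqP.
have /esym/eqP := normsqE p n%:R; rewrite p0 !horner0.
rewrite psumr_eq0 => [/allP/(_ j)|i _]; last by rewrite exprn_ge0.
by rewrite mem_index_enum expf_eq0 normr_eq0 => /(_ isT)/eqP.
Qed.

Theorem corollary1p1 (R : realType) (d : nat) :
  (forall (k : nat) (p : 'I_k -> {poly R[i]}),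
     (exists j, p j != 0) ->
     (exists s : polyzz R, forall z : R[i],
        \sum_(j < k) `|(p j).[z]| ^+ 2 =
        (1 + `|z| ^+ 2) ^+ d * s.[z, z^*]) ->
     (d.+1 <= rankzz (normsq p))%N)
  /\
  (exists (k : nat) (p : 'I_k -> {poly R[i]}),
     [/\ exists j, p j != 0,
         exists s : polyzz R, forall z : R[i],
           \sum_(j < k) `|(p j).[z]| ^+ 2 =
           (1 + `|z| ^+ 2) ^+ d * s.[z, z^*]
       & rankzz (normsq p) = d.+1]).
Proof.
have lower (k : nat) (p : 'I_k -> {poly R[i]}) :
     (exists j, p j != 0) ->
     (exists s : polyzz R, forall z : R[i],
        \sum_(j < k) `|(p j).[z]| ^+ 2 =
        (1 + `|z| ^+ 2) ^+ d * s.[z, z^*]) ->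
     (d.+1 <= rankzz (normsq p))%N.
  move=> p0 [s ps]; apply: (mxrank_multiple (s := s)); first exact: normsq_neq0.
  apply: polyzz_inj => z; rewrite normsqE ps.
  by rewrite !(hornerM, horner_exp, hornerD, hornerX, hornerC) normCK.
split=> //.
(* The square roots make |p_j|^2 the j-th binomial term of (1 + |z|^2)^d, so that s = 1 works. *)
pose p (j : 'I_d.+1) : {poly R[i]} := sqrtC ('C(d, j)%:R) *: 'X^j.
have p0 : exists j, p j != 0.
  by exists ord0; rewrite /p bin0 sqrtC1 scale1r expr0 oner_eq0.
have ps : exists s : polyzz R, forall z : R[i],
    \sum_(j < d.+1) `|(p j).[z]| ^+ 2 = (1 + `|z| ^+ 2) ^+ d * s.[z, z^*].
  exists 1 => z; rewrite !hornerC mulr1 exprDn; apply: eq_bigr => j _.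
  rewrite expr1n mul1r hornerZ hornerXn normrM exprMn normrX -[RHS]mulr_natl.
  by rewrite ger0_norm ?sqrtC_ge0 ?ler0n // sqrtCK -!exprM mulnC.
exists d.+1, p; split=> //; apply/eqP; rewrite eqn_leq lower // andbT.
(* Each p_j has degree at most d in z, so the matrix has at most d + 1 rows. *)
apply: leq_trans (rank_leq_row _) _.
apply: leq_trans (size_sum _ _ _) _; apply/bigmax_leqP => j _.
apply/leq_sizeP => i di; rewrite coefMC coef_map /= coefZ coefXn.
by rewrite gtn_eqF ?mulr0 ?mul0r // (leq_trans _ di).
Qed.
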